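(* Let $m\ge1$, let $w_1,\dots,w_m>0$ with $\sum_{i=1}^m w_i=1$, and for each $i\in\{1,\dots,m\}$ let $(\tau_1(i),\tau_2(i))$ be $\operatorname{CDPH}(\bm{\alpha}(i),\bm{P}(i),\bm{U}(i),\bm{Q}_1(i),\bm{Q}_2(i))$ distributed. Let $(\tau_{1,\mathrm{mix}},\tau_{2,\mathrm{mix}})$ be the mixture which is chosen to be $(\tau_1(i),\tau_2(i))$ with probability $w_i$. Then $(\tau_{1,\mathrm{mix}},\tau_{2,\mathrm{mix}})$ follows a $\operatorname{CDPH}(\bm{\alpha}_{\mathrm{mix}},\bm{P}_{\mathrm{mix}},\bm{U}_{\mathrm{mix}},\bm{Q}_{1,\mathrm{mix}},\bm{Q}_{2,\mathrm{mix}})$ distribution, where $$\bm{\alpha}_{\mathrm{mix}}:=\begin{pmatrix}w_1\bm{\alpha}(1)&w_2\bm{\alpha}(2)&\cdots&w_m\bm{\alpha}(m)\end{pmatrix}$$ and $\bm{P}_{\mathrm{mix}},\bm{U}_{\mathrm{mix}},\bm{Q}_{1,\mathrm{mix}},\bm{Q}_{2,\mathrm{mix}}$ are the block-diagonal matrices with diagonal blocks $\bm{P}(1),\dots,\bm{P}(m)$; $\bm{U}(1),\dots,\bm{U}(m)$; $\bm{Q}_1(1),\dots,\bm{Q}_1(m)$; and $\bm{Q}_2(1),\dots,\bm{Q}_2(m)$, respectively (all off-diagonal blocks zero).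
   Context: CDPH. $\mathcal{E}$ and $\mathcal{S}$ are disjoint nonempty finite sets. $\bm{\alpha}$ is a probability row vector indexed by $\mathcal{E}$; $\bm{P}$ is a subprobability matrix (nonnegative entries, row sums at most $1$) on $\mathcal{E}$; $\bm{U}$ is a nonnegative $\mathcal{E}\times\mathcal{S}$ matrix such that each row of $(\bm{P}\ \bm{U})$ sums to one; $\bm{Q}_1,\bm{Q}_2$ are subprobability matrices on $\mathcal{S}$. All chains terminate almost surely (from every state), i.e. all eigenvalues of $\bm{P},\bm{Q}_1,\bm{Q}_2$ have modulus strictly less than $1$. $M_1$ is a terminating Markov chain (time $n=0,1,2,\dots$) on $\mathcal{E}\cup\mathcal{S}$ with initial vector $(\bm{\alpha},\bm{0})$ and subprobability transition matrix $\begin{pmatrix}\bm{P}&\bm{U}\\ \bm{0}&\bm{Q}_1\end{pmatrix}$ (the missing mass in a row is the probability of terminating at the next step). Let $\tau_{1,2}:=\inf\{n\ge 1: M_1(n)\notin\mathcal{E}\}$. Set $M_2(n)=M_1(n)$ for $n\le\tau_{1,2}$; after time $\tau_{1,2}$, given the past up to $\tau_{1,2}$, $M_2$ evolves independently of $M_1$ as a terminating Markov chain in $\mathcal{S}$ with subprobability matrix $\bm{Q}_2$. For $k\in\{1,2\}$, $\tau_k:=\inf\{n\ge 1: M_k(n)\notin\mathcal{E}\cup\mathcal{S}\}$. The law of $(\tau_1,\tau_2)$ is called $\operatorname{CDPH}(\bm{\alpha},\bm{P},\bm{U},\bm{Q}_1,\bm{Q}_2)$. The index $(i)$ denotes the parameters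 (with state spaces $\mathcal{E}(i),\mathcal{S}(i)$, possibly of different sizes) of the $i$-th component; the mixing index is chosen independently of the component vectors. The mixed representation uses the disjoint unions of the $\mathcal{E}(i)$ and of the $\mathcal{S}(i)$. *)

(* Defs.v *)
From HB Require Import structures.
From mathcomp Require Export all_boot all_order all_algebra.
From mathcomp Require Export all_classical all_reals all_analysis.
From mathcomp Require Export measurable_realfun complex.

Set Implicit Arguments.
Unset Strict Implicit.
Unset Printing Implicit Defensive.

Import Order.TTheory GRing.Theory Num.Theory.

Local Open Scope classical_set_scope.
Local Open Scope ring_scope.

Section Matrices.
Context {R : realType}.

Definition is_prob_vector (n : nat) (v : 'rV[R]_n) : Prop :=
  (forall i, 0 <= v 0 i) /\ \sum_i v 0 i = 1.

Definition is_subprob_matrix (n : nat) (A : 'M[R]_n) : Prop :=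
  (forall i j, 0 <= A i j) /\ (forall i, \sum_j A i j <= 1).

Definition eigenvalues_lt1 (n : nat) (A : 'M[R]_n) : Prop :=
  forall z : complex R,
    eigenvalue (map_mx (real_complex R) A) z -> `|z| < 1.

(* E is 'I_p and S is 'I_q; their disjoint union is 'I_(p + q), with E embedded
   by lshift and S by rshift. *)
Definition CDPH_params (p q : nat) (alpha : 'rV[R]_p) (P : 'M[R]_p)
    (U : 'M[R]_(p, q)) (Q1 Q2 : 'M[R]_q) : Prop :=
  [/\ (0 < p)%N /\ (0 < q)%N,
      is_prob_vector alpha,
      [/\ is_subprob_matrix P, is_subprob_matrix Q1 & is_subprob_matrix Q2],
      (forall i j, 0 <= U i j) /\ (forall i, \sum_j row_mx P U i j = 1)
    & [/\ eigenvalues_lt1 P, eigenvalues_lt1 Q1 & eigenvalues_lt1 Q2]].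

(* The state None is the absorbing state reached on termination; it receives
   the mass that is missing from the (sub)probability vector or row. *)
Definition init_prob (n : nat) (nu : 'rV[R]_n) (x : option 'I_n) : R :=
  if x is Some i then nu 0 i else 1 - \sum_i nu 0 i.

Definition trans_prob (n : nat) (A : 'M[R]_n) (x y : option 'I_n) : R :=
  match x, y with
  | Some i, Some j => A i j
  | Some i, None => 1 - \sum_j A i j
  | None, Some _ => 0
  | None, None => 1
  end.

End Matrices.

Section Processes.
Context {R : realType} d (Omega : measurableType d).

(* The set function mu is meant to be a probability or a conditional
   probability. The Markov property is in product form, so that it also makes
   sense for pasts of probability zero. *)
Definition terminating_chain (mu : set Omega -> \bar R) (n : nat)
    (nu : 'rV[R]_n) (A : 'M[R]_n) (X : nat -> Omega -> option 'I_n) : Prop :=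
  [/\ forall t x, measurable (X t @^-1` [set x]),
      forall x, mu (X 0%N @^-1` [set x]) = (init_prob nu x)%:E
    & forall (t : nat) (x : nat -> option 'I_n),
        mu [set w | forall s, (s <= t.+1)%N -> X s w = x s] =
        (mu [set w | forall s, (s <= t)%N -> X s w = x s] *
         (trans_prob A (x t) (x t.+1))%:E)%E].

Definition cond_prob (mu : set Omega -> \bar R) (A : set Omega) :
    set Omega -> \bar R :=
  fun B => (mu (A `&` B) * ((fine (mu A))^-1)%:E)%E.

(* The sigma-algebra generated by a family (X i) of maps into a space whose
   sigma-algebra is G. *)
Definition sigma_family (I T : Type) (G : set (set T)) (X : I -> Omega -> T) :
    set (set Omega) :=
  <<s \bigcup_(i in [set: I]) preimage_set_system setT (X i) G >>.

Definition independent_systems (mu : set Omega -> \bar R)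
    (F G : set (set Omega)) : Prop :=
  forall A B, F A -> G B -> mu (A `&` B) = (mu A * mu B)%E.

Variables p q : nat.

Definition in_E (x : option 'I_(p + q)) : Prop :=
  exists i : 'I_p, x = Some (lshift q i).

(* tau_{1,2}; the infimum of the empty set is +oo. *)
Definition exit_time (M : nat -> Omega -> option 'I_(p + q)) (w : Omega) :
    \bar R :=
  ereal_inf [set (n%:R)%:E | n in [set n | (1 <= n)%N /\ ~ in_E (M n w)]].

(* tau_1 and tau_2. *)
Definition termination_time (M : nat -> Omega -> option 'I_(p + q))
    (w : Omega) : \bar R :=
  ereal_inf [set (n%:R)%:E | n in [set n | (1 <= n)%N /\ M n w = None]].

Definition past_event (M : nat -> Omega -> option 'I_(p + q)) (k : nat)
    (x : nat -> option 'I_(p + q)) : set Omega :=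
  [set w | exit_time M w = (k%:R)%:E /\
           forall j, (j <= k)%N -> M j w = x j].

(* The past up to the exit time takes countably many values, so conditioning on
   it is conditioning on each past_event of positive probability. Then M2 moves
   in S (and the absorbing state) according to Q2; this is written as a chain on
   E + S that starts in S and never enters E. *)
Definition CDPH_process (Pr : probability Omega R) (alpha : 'rV[R]_p)
    (P : 'M[R]_p) (U : 'M[R]_(p, q)) (Q1 Q2 : 'M[R]_q)
    (M1 M2 : nat -> Omega -> option 'I_(p + q)) : Prop :=
  [/\ terminating_chain Pr (row_mx alpha 0) (block_mx P U 0 Q1) M1,
      forall t x, measurable (M2 t @^-1` [set x]),
      forall n w, ((n%:R)%:E <= exit_time M1 w)%E -> M2 n w = M1 n w
    & forall (k : nat) (x : nat -> option 'I_(p + q)) (s : 'I_q),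
        x k = Some (rshift p s) -> (0 < Pr (past_event M1 k x))%E ->
        terminating_chain (cond_prob Pr (past_event M1 k x))
          (row_mx 0 (delta_mx 0 s)) (block_mx 0 0 0 Q2)
          (fun n => M2 (k + n)%N) /\
        independent_systems (cond_prob Pr (past_event M1 k x))
          (sigma_family setT M1) (sigma_family setT (fun n => M2 (k + n)%N))].

End Processes.

(* The random vector T has the law of (tau_1, tau_2), where tau_1 and tau_2 may
   live on another probability space. *)
Definition CDPH_distributed {R : realType} d (Omega : measurableType d)
    (Pr : probability Omega R) (T : Omega -> \bar R * \bar R) (p q : nat)
    (alpha : 'rV[R]_p) (P : 'M[R]_p) (U : 'M[R]_(p, q)) (Q1 Q2 : 'M[R]_q) :
    Prop :=
  [/\ CDPH_params alpha P U Q1 Q2,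
      measurable_fun setT T
    & exists (d' : measure_display) (Omega' : measurableType d')
             (Pr' : probability Omega' R)
             (M1 M2 : nat -> Omega' -> option 'I_(p + q)),
        CDPH_process Pr' alpha P U Q1 Q2 M1 M2 /\
        forall A, measurable A ->
          pushforward Pr T A =
          pushforward Pr'
            (fun w => (termination_time M1 w, termination_time M2 w)) A].

(* Rectangular counterpart of \mxdiag. *)
Definition mxdiag_rect {R : nmodType} (m : nat) (p q : 'I_m -> nat)
    (U : forall i, 'M[R]_(p i, q i)) : 'M[R]_(\sum_i p i, \sum_i q i) :=
  \mxblock_(i < m, j < m) (if i == j then conform_mx 0 (U i) else 0).

(* Main.v *)
From HB Require Import structures.
Require Import Defs.

Set Implicit Arguments.
Unset Strict Implicit.
Unset Printing Implicit Defensive.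

(** The mixture is realised on one new probability space: the disjoint union
    of the spaces that carry the component processes, where the component of
    index [i] receives the measure of its own space scaled by [w i].  On that
    component run the [i]-th pair of processes, with its states relabelled as
    those of the [i]-th block of the mixed state space.  Drawing a point of
    the union amounts to drawing [i] with probability [w i] and then running
    the [i]-th process, so that the termination times have the mixed law, by
    construction ([pushforward_mixed]) on the one side, and by independence of
    the mixing index ([pushforward_selected]) on the other.

    It remains to see that the pair of processes on the union is a CDPH process
    with the mixed parameters ([CDPH_process_mix]).
    - A block-diagonal matrix does not let a chain leave its block, so a
      relabelled chain of block [i] is a chain for the mixed transition matrix,
      started from its own initial vector padded with zeros
      ([terminating_chain_omap], [extends_block_mx]).  All components now have
      the same transition matrix, and for a fixed matrix the Markov property in
      product form is linear in the measure; hence the mixture is again a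
      chain, whose initial vector is the weighted sum of the padded ones
      ([terminating_chain_mixture], [push_row_mix]).
    - A past that ends in a state of block [i] of [S] is only possible on
      component [i].  Conditioning the mixture on such a past is therefore
      conditioning the [i]-th law, the weight [w i] cancelling
      ([cond_prob_mixture]); the conditional requirements on the second process
      are then those of component [i].

    The spectral condition holds because the restriction of an eigenvector of a
    block-diagonal matrix to a block on which it is nonzero is an eigenvector
    of that block ([eigenvalues_lt1_mxdiag]). *)

Import Order.TTheory GRing.Theory Num.Theory.

Local Open Scope classical_set_scope.
Local Open Scope ring_scope.

(** * Block-diagonal matrices *)

Lemma sum_codom (V : nmodType) (n n' : nat) (f : 'I_n -> 'I_n')
    (F : 'I_n' -> V) :
  injective f -> (forall y, y \notin codom f -> F y = 0) ->
  \sum_y F y = \sum_a F (f a).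
Proof.
move=> f_inj F0; rewrite (bigID (mem (codom f))) /= [X in _ + X]big1 // addr0.
rewrite -big_uniq /=; last by rewrite map_inj_uniq ?enum_uniq.
by rewrite big_image.
Qed.

Section Blocks.
Variables (m : nat).
Implicit Types (p q : 'I_m -> nat) (i j : 'I_m).

Lemma Rank_surj p (s : 'I_(\sum_i p i)) :
  exists i (a : 'I_(p i)), s = tagnat.Rank _ a.
Proof. by exists (tagnat.sig1 s), (tagnat.sig2 s); rewrite tagnat.sig2K. Qed.

Lemma Rank_inj p i : injective (@tagnat.Rank m p i).
Proof.
move=> a b /(congr1 val)/eqP; rewrite /= tagnat.eq_Rank eqxx /=.
by move=> /eqP/val_inj.
Qed.

Lemma Rank_neq p i j (a : 'I_(p i)) (b : 'I_(p j)) :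
  tagnat.Rank _ a = tagnat.Rank _ b -> i = j.
Proof.
by move=> /(congr1 val)/eqP; rewrite tagnat.eq_Rank => /andP[/eqP].
Qed.

Lemma notin_codom_Rank p i (s : 'I_(\sum_i p i)) :
  s \notin codom (@tagnat.Rank m p i) ->
  exists j (a : 'I_(p j)), s = tagnat.Rank _ a /\ i != j.
Proof.
have [j [a ->]] := Rank_surj s => h; exists j, a; split=> //.
by apply: contra h => /eqP ij; case: _ / ij a => a; exact: codom_f.
Qed.

Lemma sum_Rank (V : nmodType) p (F : 'I_(\sum_i p i) -> V) :
  \sum_s F s = \sum_i \sum_(a < p i) F (tagnat.Rank _ a).
Proof.
rewrite sig_big_dep /= (reindex _ tagnat.sig_bij_on) /=.
by apply: eq_bigr => s _; rewrite tagnat.sig2K.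
Qed.

Lemma sum_Rank_block (V : nmodType) p i (F : 'I_(\sum_i p i) -> V) :
  (forall j (a : 'I_(p j)), i != j -> F (tagnat.Rank _ a) = 0) ->
  \sum_s F s = \sum_(a < p i) F (tagnat.Rank _ a).
Proof.
move=> F0; apply: sum_codom (@Rank_inj p i) _ => s.
by move=> /notin_codom_Rank [j [a [-> ij]]]; exact: F0.
Qed.

(** [mxblockK] reads off a whole block; on the diagonal [conform_mx] is the
    identity because both index functions are evaluated at the same [i]. *)
Lemma mxdiag_rectE (V : nmodType) p q (B : forall i, 'M[V]_(p i, q i)) i
    (a : 'I_(p i)) (b : 'I_(q i)) :
  mxdiag_rect B (tagnat.Rank _ a) (tagnat.Rank _ b) = B i a b.
Proof.
have /matrixP/(_ a b) := mxblockK
  (fun i j => if i == j then conform_mx (0 : 'M[V]_(p i, q j)) (B i) else 0) i i.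
by rewrite mxE eqxx conform_mx_id.
Qed.

Lemma mxdiag_rect_off (V : nmodType) p q (B : forall i, 'M[V]_(p i, q i)) i j
    (a : 'I_(p i)) (b : 'I_(q j)) :
  i != j -> mxdiag_rect B (tagnat.Rank _ a) (tagnat.Rank _ b) = 0.
Proof.
move=> /negPf ij; have /matrixP/(_ a b) := mxblockK
  (fun i j => if i == j then conform_mx (0 : 'M[V]_(p i, q j)) (B i) else 0) i j.
by rewrite ij !mxE.
Qed.

Lemma mxdiagE (V : nmodType) p (B : forall i, 'M[V]_(p i)) :
  \mxdiag_i B i = mxdiag_rect B.
Proof. by []. Qed.

Lemma mxrowE_Rank (V : nmodType) p (v : forall i, 'rV[V]_(p i)) i (a : 'I_(p i)) :
  (\mxrow_i v i) 0 (tagnat.Rank _ a) = v i 0 a.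
Proof. by have /matrixP/(_ 0 a) := mxrowK v i; rewrite mxE. Qed.

End Blocks.

(** * The mixed parameters *)

Section MixedParams.
Variables (R : realType) (m : nat).
Implicit Types (p q : 'I_m -> nat).

Lemma row_sum_mxdiag_rect p q (B : forall i, 'M[R]_(p i, q i)) i (a : 'I_(p i)) :
  \sum_s mxdiag_rect B (tagnat.Rank _ a) s = \sum_b B i a b.
Proof.
rewrite (@sum_Rank_block _ _ _ i) => [|j b ij]; last exact: mxdiag_rect_off.
by apply: eq_bigr => b _; rewrite mxdiag_rectE.
Qed.

Lemma mxdiag_rect_ge0 p q (B : forall i, 'M[R]_(p i, q i)) :
  (forall i a b, 0 <= B i a b) -> forall s t, 0 <= mxdiag_rect B s t.
Proof.
move=> B0 s t; have [i [a ->]] := Rank_surj s; have [j [b ->]] := Rank_surj t.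
have [ij|ij] := eqVneq i j; last by rewrite mxdiag_rect_off.
by case: _ / ij b => b; rewrite mxdiag_rectE.
Qed.

Lemma is_subprob_mxdiag p (B : forall i, 'M[R]_(p i)) :
  (forall i, is_subprob_matrix (B i)) -> is_subprob_matrix (\mxdiag_i B i).
Proof.
move=> hB; rewrite mxdiagE; split.
  by apply: mxdiag_rect_ge0 => i; case: (hB i).
move=> s; have [i [a ->]] := Rank_surj s.
by rewrite row_sum_mxdiag_rect; case: (hB i).
Qed.

(** The restriction of a row eigenvector to a block is zero or an eigenvector of
    that block for the same eigenvalue, since the columns of the block meet no
    other row; some restriction is nonzero. *)
Lemma eigenvalues_lt1_mxdiag p (B : forall i, 'M[R]_(p i)) :
  (forall i, eigenvalues_lt1 (B i)) -> eigenvalues_lt1 (\mxdiag_i B i).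
Proof.
move=> hB z /eigenvalueP[v vB /eqP v0]; rewrite mxdiagE in vB.
have [i [a va]] : exists i (a : 'I_(p i)), v 0 (tagnat.Rank _ a) != 0.
  apply: contrapT => h; apply: v0; apply/rowP => s; rewrite mxE.
  have [i [a ->]] := Rank_surj s.
  by apply/eqP; apply: contra_notT h => va; exists i, a.
apply: (hB i); apply/eigenvalueP; exists (\row_a v 0 (tagnat.Rank _ a)).
  apply/rowP => b; have /rowP/(_ (tagnat.Rank _ b)) := vB.
  rewrite !mxE => <-; rewrite (@sum_Rank_block _ _ _ i); last first.
    move=> j c ij; rewrite mxE mxdiag_rect_off ?rmorph0 ?mulr0 //.
    by rewrite eq_sym.
  apply: eq_bigr => c _; rewrite mxE; congr (_ * _).
  by rewrite [LHS]mxE [RHS]mxE mxdiag_rectE.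
by apply: contra va => /eqP/rowP/(_ a); rewrite !mxE => ->.
Qed.

Lemma CDPH_params_mix (w : 'I_m -> R) p q (alpha : forall i, 'rV[R]_(p i))
    (P : forall i, 'M[R]_(p i)) (U : forall i, 'M[R]_(p i, q i))
    (Q1 Q2 : forall i, 'M[R]_(q i)) :
  (0 < m)%N -> (forall i, 0 < w i) -> \sum_i w i = 1 ->
  (forall i, CDPH_params (alpha i) (P i) (U i) (Q1 i) (Q2 i)) ->
  CDPH_params (\mxrow_i (w i *: alpha i)) (\mxdiag_i P i) (mxdiag_rect U)
    (\mxdiag_i Q1 i) (\mxdiag_i Q2 i).
Proof.
move=> m0 w0 w1 H.
have sum_gt0 r : (forall i, 0 < r i)%N -> (0 < \sum_(i < m) r i)%N.
  by move=> r0; rewrite (bigD1 (Ordinal m0)) //= ltn_addr.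
split.
- by split; apply: sum_gt0 => i; case: (H i) => -[].
- split=> [s|].
    have [i [a ->]] := Rank_surj s.
    rewrite mxrowE_Rank mxE mulr_ge0 ?(ltW (w0 i)) //.
    by case: (H i) => _ [alpha0 _] _ _ _; exact: alpha0.
  rewrite sum_Rank -w1; apply: eq_bigr => i _.
  transitivity (\sum_a w i * alpha i 0 a).
    by apply: eq_bigr => a _; rewrite mxrowE_Rank mxE.
  by rewrite -mulr_sumr; case: (H i) => _ [_ ->]; rewrite mulr1.
- by split; apply: is_subprob_mxdiag => i; case: (H i) => _ _ [].
- split; first by apply: mxdiag_rect_ge0 => i; case: (H i) => _ _ _ [].
  move=> s; have [i [a ->]] := Rank_surj s; rewrite big_split_ord /=.
  under eq_bigr do rewrite row_mxEl.
  under [X in _ + X]eq_bigr do rewrite row_mxEr.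
  rewrite mxdiagE !row_sum_mxdiag_rect; case: (H i) => _ _ _ [_ /(_ a) <- _].
  rewrite big_split_ord /=; under [in RHS]eq_bigr do rewrite row_mxEl.
  by under [X in _ = _ + X]eq_bigr do rewrite row_mxEr.
- by split; apply: eigenvalues_lt1_mxdiag => i; case: (H i) => _ _ _ _ [].
Qed.

End MixedParams.

(** * Mixtures on a disjoint union *)

Section Coproduct.
Context {I : finType}.

(** The index [i0] only serves to exhibit a base point, which measurable types
    are required to have. *)
Definition coproduct (i0 : I) (d : I -> measure_display)
  (T : forall i, measurableType (d i)) : Type := {i : I & T i}.

Variables (i0 : I) (d : I -> measure_display) (T : forall i, measurableType (d i)).

HB.instance Definition _ := Choice.on (coproduct i0 T).
HB.instance Definition _ :=
  isPointed.Build (coproduct i0 T) (Tagged T (point : T i0)).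

Definition coproduct_in (i : I) (x : T i) : coproduct i0 T := Tagged T x.

Arguments coproduct_in i x : clear implicits.

(** The largest sigma-algebra that makes all the injections measurable. *)
Definition coproduct_measurable (A : set (coproduct i0 T)) : Prop :=
  forall i, measurable (coproduct_in i @^-1` A).

Lemma coproduct_measurable0 : coproduct_measurable set0.
Proof. by move=> i; rewrite preimage_set0. Qed.

Lemma coproduct_measurableC A :
  coproduct_measurable A -> coproduct_measurable (~` A).
Proof. by move=> mA i; rewrite preimage_setC; exact/measurableC/mA. Qed.

Lemma coproduct_measurable_bigcup (F : (set (coproduct i0 T))^nat) :
  (forall n, coproduct_measurable (F n)) ->
  coproduct_measurable (\bigcup_n F n).
Proof.
move=> mF i; rewrite preimage_bigcup.
by apply: bigcupT_measurable => n; exact: mF.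
Qed.

HB.instance Definition _ := isMeasurable.Build default_measure_display
  (coproduct i0 T) coproduct_measurable0 coproduct_measurableC
  coproduct_measurable_bigcup.

Lemma coproduct_measurableE (A : set (coproduct i0 T)) :
  measurable A = coproduct_measurable A.
Proof. by []. Qed.

(** Sigma-additivity comes from that of each [mu i] by exchanging the sum over
    the index set with a series of nonnegative terms. *)
Lemma mixture_probability (R : realType) (w : I -> R)
    (mu : forall i, probability (T i) R) :
  (forall i, 0 < w i) -> \sum_i w i = 1 ->
  exists Pm : probability (coproduct i0 T) R, forall B,
    Pm B = (\sum_i (w i)%:E * mu i (coproduct_in i @^-1` B))%E.
Proof.
move=> w0 w1.
pose M (B : set (coproduct i0 T)) : \bar R :=
  (\sum_i (w i)%:E * mu i (coproduct_in i @^-1` B))%E.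
have M0 : M set0 = 0%E.
  by rewrite /M big1 // => i _; rewrite preimage_set0 measure0 mule0.
have Mge0 B : (0 <= M B)%E.
  by apply: sume_ge0 => i _; rewrite mule_ge0 // lee_fin ltW.
have Msa : semi_sigma_additive M.
  move=> F mF tF mUF.
  have -> : M (\bigcup_n F n) = (\sum_(0 <= n <oo) M (F n))%E.
    rewrite /M nneseries_sum => [|i n _]; last first.
      by rewrite mule_ge0 // lee_fin ltW.
    apply: eq_bigr => i _; rewrite nneseriesZl //.
    rewrite preimage_bigcup measure_semi_bigcup //.
    - by move=> n; exact: mF.
    - by move=> n k _ _ [x [xn xk]]; apply: tF => //; exists (coproduct_in i x).
  by apply: is_cvg_nneseries.
have MT : M setT = 1%E.
  rewrite /M; under eq_bigr do rewrite preimage_setT probability_setT mule1.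
  by rewrite sumEFin w1.
pose mm := isMeasure.Build _ _ _ M M0 Mge0 Msa.
pose Mm : {measure set _ -> \bar R} := HB.pack M mm.
pose pm := Measure_isProbability.Build _ _ _ Mm MT.
pose Pm : probability _ R := HB.pack M mm pm.
by exists Pm.
Qed.

End Coproduct.

Arguments coproduct_in {I i0 d T} i x.

(** * Relabelling the states of a terminating chain *)

Section ChainEmbedding.
Variables (R : realType) (n n' : nat) (f : 'I_n -> 'I_n').
Hypothesis f_inj : injective f.

(** The image measure of [nu] under [f], as a row vector. *)
Definition push_row (nu : 'rV[R]_n) : 'rV[R]_n' :=
  \row_y \sum_(x | f x == y) nu 0 x.

Lemma push_rowE nu x : push_row nu 0 (f x) = nu 0 x.
Proof.
by rewrite mxE (big_pred1 x) // => y /=; rewrite (inj_eq f_inj).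
Qed.

Lemma push_row_out nu y : y \notin codom f -> push_row nu 0 y = 0.
Proof.
move=> yf; rewrite mxE big_pred0 // => x; apply/negbTE.
by apply: contra yf => /eqP <-; exact: codom_f.
Qed.

(** The columns of [A'] outside the range of [f] vanish on the rows in it, so a
    chain with matrix [A'] cannot leave the range; its remaining rows are
    arbitrary. *)
Definition extends_mx (A : 'M[R]_n) (A' : 'M[R]_n') : Prop :=
  (forall x y, A' (f x) (f y) = A x y) /\
  (forall x y, y \notin codom f -> A' (f x) y = 0).

Lemma codom_omapP (y : option 'I_n') :
  (exists x, y = omap f x) \/ exists2 z, y = Some z & z \notin codom f.
Proof.
case: y => [z|]; last by left; exists None.
have [/codomP[x ->]|zf] := boolP (z \in codom f); last by right; exists z.
by left; exists (Some x).
Qed.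

Lemma omap_neq_out (y : option 'I_n) z : z \notin codom f -> omap f y <> Some z.
Proof. by move=> zf; case: y => //= x [zE]; rewrite -zE codom_f in zf. Qed.

Lemma init_prob_push nu x : init_prob (push_row nu) (omap f x) = init_prob nu x.
Proof.
case: x => [x|] /=; first exact: push_rowE.
rewrite (sum_codom f_inj) => [|y]; last exact: push_row_out.
by congr (_ - _); apply: eq_bigr => a _; exact: push_rowE.
Qed.

(** The delicate case is termination: the missing mass of a row is the same for
    both matrices because [A'] adds only zeros to that row. *)
Lemma trans_prob_extends A A' x y : extends_mx A A' ->
  trans_prob A' (omap f x) (omap f y) = trans_prob A x y.
Proof.
move=> [AE A0]; case: x y => [x|] [y|] //=.
rewrite (sum_codom f_inj) => [|y]; last exact: A0.
by congr (_ - _); apply: eq_bigr => b _; exact: AE.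
Qed.

(** A path within the range of [f] comes from a unique path of [X]. A path that
    leaves the range has probability zero, and if its last step is the one
    that leaves, the transition probability of that step is zero as well.
    Assuming only [mu set0 = 0] lets [mu] be a conditional probability. *)
Lemma terminating_chain_omap d (Omega : measurableType d)
    (mu : set Omega -> \bar R) nu A A' X :
  mu set0 = 0%E -> extends_mx A A' -> terminating_chain mu nu A X ->
  terminating_chain mu (push_row nu) A' (fun t o => omap f (X t o)).
Proof.
move=> mu0 AA' [Xm X0 XS]; have omap_inj := inj_omap f_inj.
have preimE t x : [set o | omap f (X t o) = omap f x] = X t @^-1` [set x].
  by apply/seteqP; split=> o /= => [/omap_inj|->].
have preim0 t z : z \notin codom f -> [set o | omap f (X t o) = Some z] = set0.
  by move=> zf; apply/seteqP; split=> o //=; exact: omap_neq_out.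
split.
- move=> t y; have [[x ->]|[z -> zf]] := codom_omapP y.
    by rewrite [X in measurable X]preimE.
  by rewrite [X in measurable X]preim0.
- move=> y; have [[x ->]|[z -> zf]] := codom_omapP y.
    by rewrite [X in mu X]preimE init_prob_push.
  by rewrite [X in mu X]preim0 // mu0 /= push_row_out.
- move=> t y.
  have path0 s r z : (s <= r)%N -> y s = Some z -> z \notin codom f ->
      [set o | forall u, (u <= r)%N -> omap f (X u o) = y u] = set0.
    move=> sr ysz zf; apply/seteqP; split=> o //= /(_ s sr).
    by rewrite ysz; exact: omap_neq_out.
  (* The path leaves the range before its last step: both sides vanish. *)
  have [[s [z [st ysz zf]]]|yf] :=
      pselect (exists s z, [/\ (s <= t)%N, y s = Some z & z \notin codom f]).
    by rewrite !(path0 s _ z) // ?mu0 ?mul0e // leqW.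
  have {}yf s : (s <= t)%N -> exists x, y s = omap f x.
    move=> st; have [//|[z ysz zf]] := codom_omapP (y s).
    by case: yf; exists s, z.
  (* The path leaves the range at its last step. *)
  have [[x1 yx1]|[z ytz zf]] := codom_omapP (y t.+1); last first.
    rewrite (path0 t.+1 _ z) // mu0 ytz; have [x ->] := yf t (leqnn t).
    case: x => [x|] /=; last by rewrite mule0.
    by rewrite (proj2 AA') // mule0.
  (* The path stays in the range: lift it to a path [x] of [X]; beyond time
     [t.+1] the lift is arbitrary. *)
  have {x1 yx1}yf s : exists x, (s <= t.+1)%N -> y s = omap f x.
    case: (leqP s t) => st; first by have [x yx] := yf s st; exists x.
    case: (eqVneq s t.+1) => [->|ne]; first by exists x1.
    exists None; rewrite leq_eqVlt (negPf ne) /= ltnS.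
    by rewrite leqNgt st.
  have [x xE] := choice yf.
  have pathE r : (r <= t.+1)%N ->
      [set o | forall u, (u <= r)%N -> omap f (X u o) = y u] =
      [set o | forall u, (u <= r)%N -> X u o = x u].
    move=> rt; apply/seteqP; split=> o /= h u ur; have := h u ur.
      by rewrite xE ?(leq_trans ur) // => /omap_inj.
    by rewrite xE ?(leq_trans ur) // => ->.
  by rewrite !pathE ?XS ?xE ?(trans_prob_extends _ _ AA') // ltnW.
Qed.

End ChainEmbedding.

(** * Chains and conditioning under a mixture *)

(** The mass of the absorbing state is affine, not linear, in [nu]; this is
    where [\sum_i w i = 1] enters. *)
Lemma init_prob_sum (R : realType) (I : finType) n (w : I -> R)
    (nu : I -> 'rV[R]_n) x :
  \sum_i w i = 1 ->
  init_prob (\sum_i w i *: nu i) x = \sum_i w i * init_prob (nu i) x.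
Proof.
move=> w1; case: x => [y|] /=.
  by rewrite summxE; apply: eq_bigr => i _; rewrite mxE.
under [in RHS]eq_bigr do rewrite mulrBr mulr1 mulr_sumr.
rewrite sumrB w1 exchange_big /=; congr (_ - _); apply: eq_bigr => y _.
by rewrite summxE; apply: eq_bigr => i _; rewrite mxE.
Qed.

Section CoproductChains.
Context {R : realType} {I : finType} {i0 : I} {d : I -> measure_display}
  {T : forall i, measurableType (d i)}.
Variables (w : I -> R) (mu : forall i, probability (T i) R)
  (Pm : probability (coproduct i0 T) R).
Hypotheses (w0 : forall i, 0 < w i) (w1 : \sum_i w i = 1).
Hypothesis PmE : forall B,
  Pm B = (\sum_i (w i)%:E * mu i (coproduct_in i @^-1` B))%E.

(** The transition probability of a step does not depend on the component, so
    it factors out of the weighted sum of the path probabilities. *)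
Lemma terminating_chain_mixture n (nu : I -> 'rV[R]_n) A X :
  (forall i, terminating_chain (mu i) (nu i) A
    (fun t o => X t (coproduct_in i o))) ->
  terminating_chain Pm (\sum_i w i *: nu i) A X.
Proof.
move=> H; split.
- by move=> t x; rewrite coproduct_measurableE => i; case: (H i) => + _ _; apply.
- move=> x; rewrite PmE init_prob_sum // -sumEFin; apply: eq_bigr => i _.
  by case: (H i) => _ Hi _; rewrite [X in (_ * X)%E]Hi.
- move=> t x; rewrite !PmE.
  have mu_ge0 i B : (0 <= (w i)%:E * mu i B)%E.
    by rewrite mule_ge0 // lee_fin ltW.
  rewrite ge0_sume_distrl //; apply: eq_bigr => i _; rewrite -muleA.
  by case: (H i) => _ _ Hi; rewrite -[X in (_ = _ * X)%E]Hi.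
Qed.

Lemma mixture_one i C : (forall j, i != j -> coproduct_in j @^-1` C = set0) ->
  Pm C = ((w i)%:E * mu i (coproduct_in i @^-1` C))%E.
Proof.
move=> C0; rewrite PmE (bigD1 i) //= big1 ?adde0 // => j ji.
by rewrite C0 ?measure0 ?mule0 // eq_sym.
Qed.

(** An event that meets a single component has conditional probabilities that
    do not see its weight. The computation is valid for arbitrary sets, also
    when [fine] discards an infinite value. *)
Lemma cond_prob_mixture i C B :
  (forall j, i != j -> coproduct_in j @^-1` C = set0) ->
  cond_prob Pm C B = cond_prob (mu i) (coproduct_in i @^-1` C)
                                      (coproduct_in i @^-1` B).
Proof.
move=> C0; rewrite /cond_prob !(@mixture_one i) // => [|j ij]; last first.
  by rewrite preimage_setI C0 ?set0I.
rewrite preimage_setI; set a := mu i _; set b := mu i _.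
have -> : fine ((w i)%:E * b)%E = w i * fine b.
  case: b => [b| |] //=; rewrite ?mulr0.
    by rewrite gt0_muley ?lte_fin.
  by rewrite gt0_muleNy ?lte_fin.
rewrite invfM mulrC EFinM [RHS]/= [((w i)%:E * a)%E]muleC -muleA.
rewrite [X in (_ * X)%E]muleCA -EFinM mulfV ?mulr1 //.
by rewrite gt_eqF.
Qed.

End CoproductChains.

(** * Generated sigma-algebras *)

Section SigmaFamilies.
Context {T I : Type}.

Lemma sigma_family_preimage d1 (O1 : measurableType d1)
    d2 (O2 : measurableType d2)
    (g : O1 -> O2) (G : set (set T)) (X : I -> O2 -> T) A :
  sigma_family G X A -> sigma_family G (fun i o => X i (g o)) (g @^-1` A).
Proof.
apply: (@smallest_sub _ _ _
  [set B | sigma_family G (fun i o => X i (g o)) (g @^-1` B)]).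
  have [s0 sC sU] := smallest_sigma_algebra setT
    (\bigcup_(i in [set: I]) preimage_set_system setT (fun o => X i (g o)) G).
  split => /= [|B|F]; first by rewrite preimage_set0.
    exact: sC.
  by move=> /sU; rewrite preimage_bigcup.
move=> B [i _ [C GC <-]] /=; apply: sub_sigma_algebra; exists i => //.
by exists C => //; rewrite !setTI.
Qed.

Lemma sigma_family_comp d (O : measurableType d) (T' : Type) (h : T -> T')
    (X : I -> O -> T) A :
  sigma_family setT (fun i o => h (X i o)) A -> sigma_family setT X A.
Proof.
apply: smallest_sub; first exact: smallest_sigma_algebra.
move=> B [i _ [C _ <-]] /=; apply: sub_sigma_algebra; exists i => //.
by exists (h @^-1` C).
Qed.

End SigmaFamilies.

(** * The states of a component among the mixed states *)

Section BlockEmbedding.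
Variables (m : nat) (p q : 'I_m -> nat).
Implicit Types (i j : 'I_m).

Definition block_embed i (x : 'I_(p i + q i)) : 'I_(\sum_i p i + \sum_i q i) :=
  match fintype.split x with
  | inl a => lshift _ (tagnat.Rank i a)
  | inr b => rshift _ (tagnat.Rank i b)
  end.

Lemma block_embedl i (a : 'I_(p i)) :
  block_embed (lshift (q i) a) = lshift _ (tagnat.Rank i a).
Proof. by rewrite /block_embed (unsplitK (inl a)). Qed.

Lemma block_embedr i (b : 'I_(q i)) :
  block_embed (rshift (p i) b) = rshift _ (tagnat.Rank i b).
Proof. by rewrite /block_embed (unsplitK (inr b)). Qed.

Lemma block_embed_inj i : injective (@block_embed i).
Proof.
move=> x y; case: (split_ordP x) => a ->; case: (split_ordP y) => b ->;
  rewrite !(block_embedl, block_embedr).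
- by move=> /lshift_inj/Rank_inj ->.
- by move=> /eqP; rewrite eq_lrshift.
- by move=> /eqP; rewrite eq_rlshift.
- by move=> /rshift_inj/Rank_inj ->.
Qed.

Lemma block_embed_neq i j (x : 'I_(p i + q i)) (y : 'I_(p j + q j)) :
  block_embed x = block_embed y -> i = j.
Proof.
case: (split_ordP x) => a ->; case: (split_ordP y) => b ->;
  rewrite !(block_embedl, block_embedr).
- by move=> /lshift_inj/Rank_neq.
- by move=> /eqP; rewrite eq_lrshift.
- by move=> /eqP; rewrite eq_rlshift.
- by move=> /rshift_inj/Rank_neq.
Qed.

Lemma block_embed_surj y : exists i (x : 'I_(p i + q i)), y = block_embed x.
Proof.
case: (split_ordP y) => s ->; have [i [a ->]] := Rank_surj s.
  by exists i, (lshift _ a); rewrite block_embedl.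
by exists i, (rshift _ a); rewrite block_embedr.
Qed.

Lemma notin_codom_block_embed i y : y \notin codom (@block_embed i) ->
  exists j (x : 'I_(p j + q j)), y = block_embed x /\ i != j.
Proof.
have [j [x ->]] := block_embed_surj y => h; exists j, x; split=> //.
by apply: contra h => /eqP ij; case: _ / ij x => x; exact: codom_f.
Qed.

Lemma mxdiag_rect0 (V : nmodType) r s :
  mxdiag_rect (fun i : 'I_m => (0 : 'M[V]_(r i, s i))) = 0.
Proof.
apply/matrixP => x y; have [i [a ->]] := Rank_surj x.
have [j [b ->]] := Rank_surj y.
have [ij|ij] := eqVneq i j; last by rewrite mxdiag_rect_off // mxE.
by case: _ / ij b => b; rewrite mxdiag_rectE !mxE.
Qed.

Variable R : realType.

(** Stated with four block-diagonal parts so that it also covers the matrices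
    with zero parts, zero being block-diagonal ([mxdiag_rect0]). *)
Lemma extends_block_mx (A : forall i, 'M[R]_(p i)) (B : forall i, 'M[R]_(p i, q i))
    (C : forall i, 'M[R]_(q i, p i)) (D : forall i, 'M[R]_(q i)) i :
  extends_mx (@block_embed i) (block_mx (A i) (B i) (C i) (D i))
    (block_mx (mxdiag_rect A) (mxdiag_rect B) (mxdiag_rect C) (mxdiag_rect D)).
Proof.
split=> [x y|x y /notin_codom_block_embed[j [z [-> ij]]]].
  case: (split_ordP x) => a ->; case: (split_ordP y) => b ->;
  by rewrite !(block_embedl, block_embedr)
    !(block_mxEul, block_mxEur, block_mxEdl, block_mxEdr) mxdiag_rectE.
case: (split_ordP x) => a ->; case: (split_ordP z) => b ->;
by rewrite !(block_embedl, block_embedr)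
  !(block_mxEul, block_mxEur, block_mxEdl, block_mxEdr) mxdiag_rect_off.
Qed.

Lemma push_row_block_neq i j nu (x : 'I_(p j + q j)) : i != j ->
  push_row (R := R) (@block_embed i) nu 0 (block_embed x) = 0.
Proof.
move=> ij; rewrite push_row_out //.
by apply: contra ij => /codomP[y /block_embed_neq ->].
Qed.

Lemma push_row_mix (w : 'I_m -> R) (alpha : forall i, 'rV[R]_(p i)) :
  \sum_i w i *: push_row (@block_embed i) (row_mx (alpha i) 0) =
  row_mx (\mxrow_i (w i *: alpha i)) 0.
Proof.
apply/rowP => y; have [i [x ->]] := block_embed_surj y.
rewrite summxE; transitivity
  (w i * push_row (@block_embed i) (row_mx (alpha i) 0) 0 (block_embed x)).
  rewrite [LHS](bigD1 i) //= [X in _ + X]big1 => [|j ji].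
    by rewrite addr0 mxE.
  by rewrite mxE push_row_block_neq ?mulr0.
rewrite (push_rowE (@block_embed_inj i)).
case: (split_ordP x) => a ->; rewrite (block_embedl, block_embedr).
  by rewrite !row_mxEl mxrowE_Rank mxE.
by rewrite !row_mxEr !mxE mulr0.
Qed.

Lemma push_row_delta i (b : 'I_(q i)) :
  push_row (@block_embed i) (row_mx 0 (delta_mx 0 b)) =
  row_mx 0 (delta_mx 0 (tagnat.Rank i b)) :> 'rV[R]_(_ + _).
Proof.
apply/rowP => y; have [j [x ->]] := block_embed_surj y.
have [ij|ij] := eqVneq i j; last first.
  rewrite push_row_block_neq //.
  case: (split_ordP x) => a ->; rewrite (block_embedl, block_embedr).
    by rewrite row_mxEl mxE.
  rewrite row_mxEr mxE /=; case: eqP => // /Rank_neq ji.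
  by rewrite ji eqxx in ij.
case: _ / ij x => x; rewrite (push_rowE (@block_embed_inj i)).
case: (split_ordP x) => a ->; rewrite (block_embedl, block_embedr).
  by rewrite !row_mxEl !mxE.
by rewrite !row_mxEr !mxE (inj_eq (@Rank_inj _ _ _)).
Qed.

End BlockEmbedding.

(** * The mixed process *)

Section MixedProcess.
Variables (R : realType) (m : nat) (p q : 'I_m -> nat) (i0 : 'I_m)
  (d : 'I_m -> measure_display) (T : forall i, measurableType (d i)).
Implicit Types i j : 'I_m.

Local Notation family := (forall i, nat -> T i -> option 'I_(p i + q i)).

Definition mixed_process (M : family) (n : nat) (o : coproduct i0 T) :
    option 'I_(\sum_i p i + \sum_i q i) :=
  omap (@block_embed m p q (tag o)) (M (tag o) n (tagged o)).

Lemma in_E_block_embed i (x : option 'I_(p i + q i)) :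
  in_E (omap (@block_embed m p q i) x) <-> in_E x.
Proof.
split=> [[s]|[a ->]]; last by exists (tagnat.Rank i a); rewrite /= block_embedl.
case: x => //= x; case: (split_ordP x) => a ->; first by exists a.
by rewrite block_embedr => /Some_inj/eqP; rewrite eq_rlshift.
Qed.

(** Relabelling preserves membership in [E] and termination, so each time is
    that of the component on which it is evaluated. *)
Lemma exit_time_mixed (M : family) i (o : T i) :
  exit_time (R := R) (mixed_process M) (coproduct_in i o) =
  exit_time (R := R) (M i) o.
Proof.
congr (ereal_inf (_ @` _)); apply/seteqP.
by split=> n [n1 h]; split=> // hE; apply: h; apply/in_E_block_embed.
Qed.

Lemma termination_time_mixed (M : family) i (o : T i) :
  termination_time (R := R) (mixed_process M) (coproduct_in i o) =
  termination_time (R := R) (M i) o.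
Proof.
congr (ereal_inf (_ @` _)); apply/seteqP; rewrite /mixed_process /=.
split=> n [n1] h; split=> //; first by case: (M i n o) h.
by rewrite h.
Qed.

(** Processes on component [j] never visit states of another block. *)
Lemma past_event_mixed_neq (M : family) i j k x (z : 'I_(p i + q i)) :
  x k = Some (block_embed z) -> i != j ->
  coproduct_in j @^-1` past_event (R := R) (mixed_process M) k x = set0.
Proof.
move=> xk ij; apply/seteqP; split=> // o [_ /(_ k (leqnn k))].
rewrite xk /mixed_process /=; case: (M j k o) => //= y [/block_embed_neq ji].
by rewrite ji eqxx in ij.
Qed.

(** Any point of the event provides the lift [x'] of the path [x]. *)
Lemma past_event_mixed (M : family) i k x :
  coproduct_in i @^-1` past_event (R := R) (mixed_process M) k x !=set0 ->
  exists x' : nat -> option 'I_(p i + q i),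
    (forall t, (t <= k)%N -> x t = omap (@block_embed m p q i) (x' t)) /\
    coproduct_in i @^-1` past_event (R := R) (mixed_process M) k x =
    past_event (R := R) (M i) k x'.
Proof.
move=> [u [_ ox]]; exists (fun n => M i n u); split=> [t tk|].
  by rewrite -ox.
have emb_inj := inj_omap (@block_embed_inj m p q i).
apply/seteqP; split=> o' [ek h]; split; rewrite ?exit_time_mixed // in ek *.
  by move=> t tk; apply: emb_inj; rewrite [LHS](h t tk) -ox.
by move=> t tk; rewrite -ox // /mixed_process /= h.
Qed.

End MixedProcess.

(** Only component [i] can realise a past that ends in block [i], so the
    conditional clauses on [M2] are those of component [i], relabelled. *)
Lemma CDPH_process_mix (R : realType) (m : nat) (i0 : 'I_m)
    (w : 'I_m -> R) (p q : 'I_m -> nat)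
    (alpha : forall i, 'rV[R]_(p i)) (P : forall i, 'M[R]_(p i))
    (U : forall i, 'M[R]_(p i, q i)) (Q1 Q2 : forall i, 'M[R]_(q i))
    (d : 'I_m -> measure_display) (T : forall i, measurableType (d i))
    (mu : forall i, probability (T i) R)
    (Pm : probability (coproduct i0 T) R)
    (M1 M2 : forall i, nat -> T i -> option 'I_(p i + q i)) :
  (forall i, 0 < w i) -> \sum_i w i = 1 ->
  (forall B, Pm B = (\sum_i (w i)%:E * mu i (coproduct_in i @^-1` B))%E) ->
  (forall i, CDPH_process (mu i) (alpha i) (P i) (U i) (Q1 i) (Q2 i)
    (M1 i) (M2 i)) ->
  CDPH_process Pm (\mxrow_i (w i *: alpha i)) (\mxdiag_i P i) (mxdiag_rect U)
    (\mxdiag_i Q1 i) (\mxdiag_i Q2 i)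
    (mixed_process (i0 := i0) M1) (mixed_process (i0 := i0) M2).
Proof.
move=> w0 w1 PmE H.
have M2m t y : measurable (mixed_process (i0 := i0) M2 t @^-1` [set y]).
  rewrite coproduct_measurableE => i; case: (H i) => _ M2m _ _.
  have [[x ->]|[z -> zf]] := codom_omapP (@block_embed m p q i) y.
    rewrite [X in measurable X](_ : _ = M2 i t @^-1` [set x]) //.
    apply/seteqP; split=> o /=; last by move=> <-.
    exact/inj_omap/block_embed_inj.
  rewrite [X in measurable X](_ : _ = set0) //.
  by apply/seteqP; split=> o //=; exact: omap_neq_out.
rewrite !mxdiagE; split=> //.
- rewrite -push_row_mix -(@mxdiag_rect0 m R q p).
  apply: (terminating_chain_mixture w0 w1 PmE) => i.
  apply: terminating_chain_omap; [exact: block_embed_inj|exact: measure0| |].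
    exact: (extends_block_mx P U (fun=> 0) Q1 i).
  by case: (H i).
- move=> n [i o]; rewrite [exit_time _ _]exit_time_mixed => nt.
  by case: (H i) => _ _ /(_ n o nt) h _; rewrite /mixed_process /= h.
- move=> k x s xk Pc; have [i [a sE]] := Rank_surj s.
  have xkE : x k = Some (block_embed (rshift (p i) a)).
    by rewrite block_embedr -sE.
  have C0 j : i != j ->
      coproduct_in j @^-1`
        past_event (R := R) (mixed_process (i0 := i0) M1) k x = set0.
    exact: past_event_mixed_neq xkE.
  (* From here on everything takes place on component [i]. *)
  have condE B := cond_prob_mixture w0 PmE B C0.
  have Pi : (0 < mu i (coproduct_in i @^-1`
      past_event (R := R) (mixed_process (i0 := i0) M1) k x))%E.
    move: Pc; rewrite (mixture_one PmE C0).
    by rewrite pmule_rgt0 ?lte_fin.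
  have [|x' [xx' pE]] := @past_event_mixed R _ _ _ i0 _ T M1 i k x.
    by apply/set0P/eqP => e; rewrite e measure0 ltxx in Pi.
  rewrite pE in Pi condE.
  have x'k : x' k = Some (rshift (p i) a).
    apply: (inj_omap (@block_embed_inj m p q i)).
    exact: etrans (esym (xx' k (leqnn k))) xkE.
  case: (H i) => _ _ _ /(_ k x' a x'k Pi) [chain2 indep].
  split.
  + have cond0 : cond_prob (mu i) (past_event (R := R) (M1 i) k x') set0 = 0%E.
      by rewrite /cond_prob setI0 measure0 mul0e.
    have := terminating_chain_omap (@block_embed_inj m p q i) cond0
      (extends_block_mx (fun=> 0) (fun=> 0) (fun=> 0) Q2 i) chain2.
    rewrite !mxdiag_rect0 push_row_delta -sE => -[_ c0 cS]; split=> //.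
    * by move=> y; rewrite condE; exact: c0.
    * by move=> t y; rewrite !condE; exact: cS.
  + move=> A B FA FB; rewrite !condE preimage_setI; apply: indep.
    * have := sigma_family_preimage (g := coproduct_in i) FA.
      exact: (sigma_family_comp (h := omap (@block_embed m p q i)) (X := M1 i)).
    * have := sigma_family_preimage (g := coproduct_in i) FB.
      exact: (sigma_family_comp (h := omap (@block_embed m p q i))
        (X := fun n => M2 i (k + n)%N)).
Qed.

(** * Laws of the termination times *)

(** Splitting along the values of [J], independence turns each piece into a
    product. *)
Lemma pushforward_selected (R : realType) (m : nat) d (Omega : measurableType d)
    d' (V : measurableType d') (Pr : probability Omega R)
    (tau : 'I_m -> Omega -> V) (J : Omega -> 'I_m) :
  (forall i, measurable_fun setT (tau i)) ->
  (forall i, measurable (J @^-1` [set i])) ->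
  independent_systems Pr
    (sigma_family setT (fun _ : unit => J)) (sigma_family measurable tau) ->
  measurable_fun setT (fun o => tau (J o) o) /\
  forall A, measurable A ->
    pushforward Pr (fun o => tau (J o) o) A =
    (\sum_i Pr (J @^-1` [set i]) * pushforward Pr (tau i) A)%E.
Proof.
move=> mtau mJ indep.
have mtauA i A : measurable A -> measurable (tau i @^-1` A).
  by move=> mA; rewrite -[X in measurable X]setTI; exact: mtau.
have mJA i A : measurable A -> measurable (J @^-1` [set i] `&` tau i @^-1` A).
  by move=> mA; apply: measurableI => //; exact: mtauA.
have splitE A : (fun o => tau (J o) o) @^-1` A =
    \big[setU/set0]_(i in predT) (J @^-1` [set i] `&` tau i @^-1` A).
  rewrite -bigcup_pred.
  by apply/seteqP; split=> [u h|u [i _ [/= <-]] //]; exists (J u).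
split=> [_ A mA|A mA].
  rewrite setTI splitE; apply: bigsetU_measurable => i _; exact: mJA.
rewrite /pushforward splitE measure_bigsetU_ord; first last.
- by move=> i j _ _ [u [[/= <- _] [/= <- _]]].
- by move=> i; exact: mJA.
apply: eq_bigr => i _; apply: indep; apply: sub_sigma_algebra.
  by exists tt => //; exists [set i] => //; rewrite setTI.
by exists i => //; exists A => //; rewrite setTI.
Qed.

Lemma pushforward_mixed (R : realType) (m : nat) (i0 : 'I_m) (w : 'I_m -> R)
    (p q : 'I_m -> nat)
    (d : 'I_m -> measure_display) (T : forall i, measurableType (d i))
    (mu : forall i, probability (T i) R)
    (Pm : probability (coproduct i0 T) R)
    (M1 M2 : forall i, nat -> T i -> option 'I_(p i + q i))
    (A : set (\bar R * \bar R)) :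
  (forall B, Pm B = (\sum_i (w i)%:E * mu i (coproduct_in i @^-1` B))%E) ->
  pushforward Pm (fun o => (termination_time (mixed_process M1) o,
                            termination_time (mixed_process M2) o)) A =
  (\sum_i (w i)%:E * pushforward (mu i)
    (fun o => (termination_time (M1 i) o, termination_time (M2 i) o)) A)%E.
Proof.
move=> PmE; rewrite /pushforward PmE; apply: eq_bigr => i _.
congr (_ * mu i _)%E.
by apply/seteqP; split=> o /=; rewrite !termination_time_mixed.
Qed.

(** The existential witness in [CDPH_distributed] as a single object, so that
    one witness can be chosen for each component at once. *)
Record CDPH_model (R : realType) (p q : nat) (alpha : 'rV[R]_p) (P : 'M[R]_p)
    (U : 'M[R]_(p, q)) (Q1 Q2 : 'M[R]_q)
    (law : set (\bar R * \bar R) -> \bar R) := CDPHModel {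
  model_display : measure_display;
  model_space : measurableType model_display;
  model_prob : probability model_space R;
  model_M1 : nat -> model_space -> option 'I_(p + q);
  model_M2 : nat -> model_space -> option 'I_(p + q);
  model_process : CDPH_process model_prob alpha P U Q1 Q2 model_M1 model_M2;
  model_law : forall A, measurable A -> law A = pushforward model_prob
    (fun o => (termination_time model_M1 o, termination_time model_M2 o)) A
}.

(* tau i is the pair (tau_1(i), tau_2(i)) and J is the mixing index. *)
Theorem proposition2p8 (R : realType) (m : nat) (hm : (0 < m)%N)
  (w : 'I_m -> R) (hw : forall i, 0 < w i) (hw1 : \sum_i w i = 1)
  (p q : 'I_m -> nat)
  (alpha : forall i, 'rV[R]_(p i)) (P : forall i, 'M[R]_(p i))
  (U : forall i, 'M[R]_(p i, q i)) (Q1 Q2 : forall i, 'M[R]_(q i))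
  (d : measure_display) (Omega : measurableType d) (Pr : probability Omega R)
  (tau : 'I_m -> Omega -> \bar R * \bar R)
  (htau : forall i,
    CDPH_distributed Pr (tau i) (alpha i) (P i) (U i) (Q1 i) (Q2 i))
  (J : Omega -> 'I_m)
  (hJ : forall i, measurable (J @^-1` [set i]))
  (hJw : forall i, Pr (J @^-1` [set i]) = (w i)%:E)
  (hJtau : independent_systems Pr
    (sigma_family setT (fun _ : unit => J)) (sigma_family measurable tau)) :
  CDPH_distributed Pr (fun o => tau (J o) o)
    (\mxrow_(i < m) (w i *: alpha i))
    (\mxdiag_(i < m) P i)
    (mxdiag_rect U)
    (\mxdiag_(i < m) Q1 i)
    (\mxdiag_(i < m) Q2 i).
Proof.
have mtau i : measurable_fun setT (tau i) by case: (htau i).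
have [mtauJ lawJ] := pushforward_selected mtau hJ hJtau.
have model i : CDPH_model (alpha i) (P i) (U i) (Q1 i) (Q2 i)
    (pushforward Pr (tau i)).
  apply: inhabited_witness.
  case: (htau i) => _ _ [d' [T' [mu [M1 [M2 [? ?]]]]]].
  by split; exists d' T' mu M1 M2.
pose mu i := model_prob (model i).
have [Pm PmE] := mixture_probability (Ordinal hm) mu hw hw1.
split=> //; first by apply: CDPH_params_mix => // i; case: (htau i).
exists default_measure_display, _, Pm,
  (mixed_process (fun i => model_M1 (c := model i))),
  (mixed_process (fun i => model_M2 (c := model i))).
split.
  by apply: (CDPH_process_mix hw hw1 PmE) => i; exact: model_process.
move=> A mA; rewrite lawJ // (pushforward_mixed _ _ _ PmE).
by apply: eq_bigr => i _; rewrite hJw (model_law (model i) mA).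
Qed.
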